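(* Let $R$ be an arbitrary ring, let $n\geq 1$ be an integer, and let $L$ and $M$ be uniform left $R$-modules, both of finite length $n$. The following are equivalent: (i) $L$ is isomorphic to $M$. (ii) There exist two $R$-module morphisms $f: L\to M$, $g: M\to L$ and a nonzero element $x\in L$ such that $(g\circ f)(x)=x$. (iii) There exist $n$ $R$-module morphisms $f_1, \ldots , f_n$, where $f_i: L\to M$ for $i$ odd and $f_i: M\to L$ for $i$ even, such that $f_n\circ \cdots \circ f_1\neq 0$.
   Context: Rings are associative with identity, and modules are left modules. A module is uniform if the intersection of any two of its nonzero submodules is nonzero. The length of a module of finite length is its composition length. *)

(* Defs.v *)
From HB Require Import structures.
From mathcomp Require Import all_boot all_order all_algebra.
From mathcomp Require Import boolp classical_sets.

Set Implicit Arguments.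
Unset Strict Implicit.
Unset Printing Implicit Defensive.

Import GRing.Theory.

Local Open Scope classical_set_scope.
Local Open Scope ring_scope.

Section Modules.
Variable R : pzRingType.

Definition submodule (V : lmodType R) (A : set V) : Prop :=
  submod_closed (mem A).

Definition uniform (V : lmodType R) : Prop :=
  forall A B : set V, submodule A -> submodule B ->
    A <> [set 0] -> B <> [set 0] -> A `&` B <> [set 0].

(* The factor B / A is a simple module: by the correspondence theorem its
   submodules are the submodules lying between A and B. *)
Definition simple_factor (V : lmodType R) (A B : set V) : Prop :=
  A `<` B /\
  forall C : set V, submodule C -> A `<=` C -> C `<=` B -> C = A \/ C = B.

Definition composition_series (V : lmodType R) (n : nat)
    (N : 'I_n.+1 -> set V) : Prop :=
  [/\ forall i, submodule (N i),
      N ord0 = [set 0],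
      N ord_max = [set: V]
    & forall i : 'I_n,
        simple_factor (N (widen_ord (leqnSn n) i)) (N (lift ord0 i))].

(* By the Jordan-Hoelder theorem, at most one n satisfies this for a given V. *)
Definition has_length (V : lmodType R) (n : nat) : Prop :=
  exists N : 'I_n.+1 -> set V, composition_series N.

Definition isomorphic (V W : lmodType R) : Prop :=
  exists f : {linear V -> W}, bijective f.

Section Alternating.
Variables L M : lmodType R.

(* The sequence L, M, L, M, ... *)
Definition alt (k : nat) : lmodType R := if odd k then M else L.

(* For a family f indexed from 0, f i is the morphism usually numbered i + 1:
   it goes from L to M when i + 1 is odd and from M to L when i + 1 is even.
   The result is f (n - 1) \o ... \o f 1 \o f 0. *)
Fixpoint alt_comp (n : nat) :
    (forall i : 'I_n, {linear alt i -> alt i.+1}) -> L -> alt n :=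
  match n with
  | 0 => fun _ => id
  | n'.+1 => fun f =>
      f ord_max \o alt_comp (fun i : 'I_n' => f (widen_ord (leqnSn n') i))
  end.

End Alternating.
End Modules.

(* Main.v *)
(** The proof counts lengths with strict chains of submodules: relative to a
    composition series of length [n], a submodule is recorded by the set of
    steps of the series at which it jumps, and this set grows strictly with the
    submodule, so a strict chain has at most [n] steps. Hence an injective
    morphism between [L] and [M] is bijective. If no such morphism existed, then
    by uniformity the kernel of each morphism of an alternating composition
    would meet the nonzero image of the preceding ones, so the kernels of the
    partial compositions together with [L] would be a chain with [n + 1] steps. *)
Require Import Defs.
From HB Require Import structures.
From mathcomp Require Import all_boot all_order all_algebra.
From mathcomp Require Import boolp classical_sets.

Set Implicit Arguments.
Unset Strict Implicit.
Unset Printing Implicit Defensive.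

Import GRing.Theory.

Local Open Scope classical_set_scope.
Local Open Scope ring_scope.

(** * Submodule calculus, uniformity in terms of elements, kernels and inverses *)

Section Submodules.
Variable R : pzRingType.
Implicit Types V W : lmodType R.

Lemma submoduleP V (A : set V) :
  submodule A <-> A 0 /\ forall a u v, A u -> A v -> A (a *: u + v).
Proof.
split=> [[A0 Alin]|[A0 Alin]].
  split=> [|a u v Au Av]; first by apply: set_mem; exact: A0.
  by apply: set_mem; apply: Alin; exact: mem_set.
split; first exact: mem_set.
by move=> a u v Au Av; apply: mem_set; apply: Alin; exact: set_mem.
Qed.

Lemma submoduleD V (A : set V) u v : submodule A -> A u -> A v -> A (u + v).
Proof. by move=> /submoduleP[_ AD] Au Av; rewrite -[u]scale1r; exact: AD. Qed.

Lemma submoduleB V (A : set V) u v : submodule A -> A u -> A v -> A (u - v).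
Proof.
by move=> /submoduleP[_ AD] Au Av; rewrite addrC -scaleN1r; exact: AD.
Qed.

Lemma submoduleT V : submodule [set: V].
Proof. by apply/submoduleP. Qed.

Lemma submoduleI V (A B : set V) :
  submodule A -> submodule B -> submodule (A `&` B).
Proof.
move=> /submoduleP[A0 AD] /submoduleP[B0 BD]; apply/submoduleP; split=> //.
by move=> a u v [Au Bu] [Av Bv]; split; [exact: AD|exact: BD].
Qed.

Lemma submodule_sum V (A B : set V) : submodule A -> submodule B ->
  submodule [set x | exists2 a, A a & B (x - a)].
Proof.
move=> /submoduleP[A0 AD] /submoduleP[B0 BD]; apply/submoduleP; split.
  by exists 0; rewrite ?subr0.
move=> c u v [a Aa Ba] [b Ab Bb]; exists (c *: a + b); first exact: AD.
by rewrite opprD addrACA -scalerBr; exact: BD.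
Qed.

Lemma submodule_ker V W (f : {linear V -> W}) : submodule [set x | f x = 0].
Proof.
apply/submoduleP; split=> [|a u v /= fu fv]; first exact: linear0.
by rewrite linearP fu fv scaler0 addr0.
Qed.

Lemma submodule_image V W (f : {linear V -> W}) (A : set V) :
  submodule A -> submodule (f @` A).
Proof.
move=> /submoduleP[A0 AD]; apply/submoduleP; split.
  by exists 0; rewrite ?linear0.
move=> a _ _ [u Au <-] [v Av <-]; exists (a *: u + v); last exact: linearP.
exact: AD.
Qed.

Lemma uniform_meet V (A B : set V) x y : uniform V ->
    submodule A -> submodule B -> A x -> x <> 0 -> B y -> y <> 0 ->
  exists2 z, z <> 0 & A z /\ B z.
Proof.
move=> uV sA sB Ax x0 By y0; apply: contrapT => noz.
have /submoduleP[AB0 _] := submoduleI sA sB.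
apply: (uV A B sA sB) => [A0|B0|].
- by apply: x0; move: Ax; rewrite A0.
- by apply: y0; move: By; rewrite B0.
- apply/seteqP; split=> [z ABz|_ ->] //=.
  by apply: contrapT => z0; apply: noz; exists z.
Qed.

Lemma ker_neq0 V W (f : {linear V -> W}) :
  ~ injective f -> exists2 x, x <> 0 & f x = 0.
Proof.
move=> finj; apply: contrapT => noz; apply: finj => x y fxy.
apply/eqP; rewrite -subr_eq0; apply/eqP; apply: contrapT => xy0; apply: noz.
by exists (x - y); rewrite ?linearB ?fxy ?subrr.
Qed.

Lemma linear_inverse V W (f : {linear V -> W}) : bijective f ->
  exists2 g : {linear W -> V}, cancel f g & cancel g f.
Proof.
move=> [g fK gK]; have glin : linear g.
  by move=> a u v; apply: (can_inj fK); rewrite linearP !gK.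
pose gL := GRing.isLinear.Build R W V _ g glin.
by pose g' : {linear W -> V} := HB.pack g gL; exists g'.
Qed.

Lemma isomorphic_sym V W : isomorphic V W -> isomorphic W V.
Proof. by move=> [f /linear_inverse[g fK gK]]; exists g; exists f. Qed.

End Submodules.

(** * Measuring submodules against a composition series *)

Section Jumps.
Variables (R : pzRingType) (V : lmodType R) (n : nat) (N : 'I_n.+1 -> set V).
Implicit Types A B : set V.

(** When [N] is a composition series and [A] a submodule, these are the steps at which the chain of
    the [A] [&] [N i] grows, each time by a simple factor, so their number is the length of [A].
    This gives a concrete bound by [n] without Jordan-Hoelder. *)
Definition jumps A : {set 'I_n} := [set i : 'I_n |
  `[< exists x, [/\ A x, N (lift ord0 i) x &
                    ~ N (widen_ord (leqnSn n) i) x] >]]%SET.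

Lemma mem_jumps A (i : 'I_n) :
  reflect (exists x, [/\ A x, N (lift ord0 i) x &
                         ~ N (widen_ord (leqnSn n) i) x]) (i \in jumps A).
Proof. by rewrite inE; exact: asboolP. Qed.

Lemma card_jumps_le A : (#|jumps A| <= n)%N.
Proof. by rewrite -[leqRHS](card_ord n); exact: max_card. Qed.

Hypothesis csN : composition_series N.

(** Strictness is the point: if every jump of [B] were one of [A], induction up the series would put
    each [B] [&] [N k] inside [A], and the top term would give [B] inside [A]. *)
Lemma jumps_proper A B :
  submodule A -> submodule B -> A `<` B -> (#|jumps A| < #|jumps B|)%N.
Proof.
have [sN N0 NT Nsimple] := csN.
move=> sA sB [AB nBA]; apply: proper_card; rewrite properE.
apply/andP; split.
  apply/fintype.subsetP => i /mem_jumps[x [Ax Nx nNx]]; apply/mem_jumps.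
  by exists x; split=> //; exact: AB.
apply/negP => /fintype.subsetP jBA; apply: nBA.
suff BN (k : nat) (kn : (k < n.+1)%N) : B `&` N (Ordinal kn) `<=` A.
  move=> x Bx; apply: (BN n (ltnSn n)); split=> //.
  by rewrite (_ : Ordinal _ = ord_max) ?NT//; exact: val_inj.
elim: k kn => [|k IHk] kn x [Bx].
  rewrite (_ : Ordinal _ = ord0) ?N0; last exact: val_inj.
  by move=> ->; have /submoduleP[] := sA.
pose i : 'I_n := Ordinal (kn : (k < n)%N).
rewrite (_ : Ordinal _ = lift ord0 i); last exact: val_inj.
move=> Nx; have {}IHk : B `&` N (widen_ord (leqnSn n) i) `<=` A.
  rewrite (_ : widen_ord _ _ = Ordinal (ltnW kn)); first exact: IHk.
  exact: val_inj.
have [|nNx] := pselect (N (widen_ord (leqnSn n) i) x).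
  by move=> Nix; exact: IHk.
(* [x] witnesses a jump of [B]; the jump of [A] it forces provides [y], which later rules out that
   [C] is the lower term. *)
have /mem_jumps[y [Ay Ny nNy]] : i \in jumps A.
  by apply: jBA; apply/mem_jumps; exists x.
have [NN nNN] := Nsimple i.
have /submoduleP[Ni0 _] := sN (widen_ord (leqnSn n) i).
(* The step is simple, so it is spanned by its part in [A] and the lower term. *)
pose C := [set z | exists2 a, (A `&` N (lift ord0 i)) a
                            & N (widen_ord (leqnSn n) i) (z - a)].
have sC : submodule C by apply: submodule_sum => //; exact: submoduleI.
have [||CN|CN] := nNN C sC.
- move=> z Nz; exists 0; rewrite ?subr0//.
  by have /submoduleP[] := submoduleI sA (sN (lift ord0 i)).
- move=> z [a [_ Na] Nza]; rewrite -(subrK a z).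
  by apply: submoduleD => //; exact: NN.1.
- by case: nNy; rewrite -CN; exists y; rewrite ?subrr.
(* Now [x - a] lies in [B] and in the lower term, so the induction hypothesis puts it in [A]. *)
have [a [Aa _] Nxa] : C x by rewrite CN.
rewrite -(subrK a x); apply: submoduleD => //; apply: IHk; split=> //.
by apply: submoduleB => //; exact: AB.
Qed.

End Jumps.

(** * Consequences of having a given length *)

Section Length.
Variable R : pzRingType.

(** Injectivity keeps the image of a series of [V] strict, so its last term already has [n] jumps in
    [W]; a value missed by [f] would force one more than the [n] available. *)
Lemma has_length_inj_bij (n : nat) (V W : lmodType R) (f : {linear V -> W}) :
  has_length V n -> has_length W n -> injective f -> bijective f.
Proof.
move=> [N [sN _ _ simpleN]] [P csP] finj.
have fN k (kn : (k < n.+1)%N) : (k <= #|jumps P (f @` N (Ordinal kn))|)%N.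
  elim: k kn => // k IHk kn; apply: leq_ltn_trans (IHk (ltnW kn)) _.
  apply: jumps_proper => //; try exact: submodule_image.
  have [[sub nsub] _] := simpleN (Ordinal (kn : (k < n)%N)).
  have -> : Ordinal (ltnW kn) = widen_ord (leqnSn n) (Ordinal (kn : (k < n)%N)).
    exact: val_inj.
  have -> : Ordinal kn = lift ord0 (Ordinal (kn : (k < n)%N)).
    exact: val_inj.
  split; first exact: image_subset.
  move=> fsub; apply: nsub => x Nx.
  by have [|y Ny /finj <-] := fsub (f x); first by exists x.
have fsurj y : exists x, f x = y.
  apply: contrapT => ny; have := card_jumps_le P [set: W].
  rewrite leqNgt => /negP; apply; apply: leq_ltn_trans (fN n (ltnSn n)) _.
  apply: jumps_proper => //; [exact: submodule_image|exact: submoduleT|].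
  split=> // /(_ y I)[x _ fx]; by apply: ny; exists x.
have [g gK] := choice fsurj; exists g => // x.
by apply: finj; rewrite gK.
Qed.

Lemma has_length_neq0 (n : nat) (V : lmodType R) :
  (0 < n)%N -> has_length V n -> exists x : V, x <> 0.
Proof.
case: n => // n _ [N [sN _ _ simpleN]]; have [[_ nNN] _] := simpleN ord0.
apply: contrapT => noz; apply: nNN => x _.
have -> : x = 0 by apply: contrapT => x0; apply: noz; exists x.
by have /submoduleP[] := sN (widen_ord (leqnSn n.+1) ord0).
Qed.

End Length.

(** * Alternating compositions and their kernels *)

Section Alternation.
Variables (R : pzRingType) (L M : lmodType R).

(** [alt_comp] returns a bare function; a linear map with the same values lets its kernel and image
    be treated as submodules. *)
Lemma alt_comp_linear k
    (f : forall i : 'I_k, {linear alt L M i -> alt L M i.+1}) :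
  exists h : {linear L -> alt L M k}, forall x, alt_comp f x = h x.
Proof.
elim: k f => [|k IHk] f; first by exists idfun.
have [h fh] := IHk (fun i => f (widen_ord (leqnSn k) i)).
exists (f ord_max \o h : {linear L -> alt L M k.+1}) => x /=.
by rewrite fh.
Qed.

Lemma alt_comp_neq0 k
    (f : forall i : 'I_k, {linear alt L M i -> alt L M i.+1}) :
  alt_comp f <> (fun=> 0) -> exists x, alt_comp f x <> 0.
Proof.
move=> f0; apply: contrapT => noz; apply: f0; apply/funext => x.
by apply: contrapT => fx; apply: noz; exists x.
Qed.

Lemma alt_not_injective k (f : {linear alt L M k -> alt L M k.+1}) :
  (forall h : {linear L -> M}, ~ injective h) ->
  (forall h : {linear M -> L}, ~ injective h) -> ~ injective f.
Proof. by move: f; rewrite /alt /=; case: (odd k) => f ? ?; auto. Qed.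

Lemma alt_uniform k : uniform L -> uniform M -> uniform (alt L M k).
Proof. by rewrite /alt; case: (odd k). Qed.

(** Each further factor strictly enlarges the kernel, so every factor contributes at least one
    jump. *)
Lemma alt_comp_ker_jumps n (N : 'I_n.+1 -> set L) k
    (f : forall i : 'I_k, {linear alt L M i -> alt L M i.+1}) :
  composition_series N -> uniform L -> uniform M ->
  (forall i, ~ injective (f i)) -> (exists x, alt_comp f x <> 0) ->
  (k <= #|jumps N [set x | alt_comp f x = 0%R]|)%N.
Proof.
move=> csN uL uM; elim: k f => // k IHk f finj [x /= fx].
set f' := fun i : 'I_k => f (widen_ord (leqnSn k) i) in fx.
have [h hE] := alt_comp_linear f'.
pose g : {linear alt L M k -> alt L M k.+1} := f ord_max.
have fE z : alt_comp f z = g (h z) by rewrite /= hE.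
have hx : h x <> 0 by move=> hx; apply: fx; rewrite -/f' hE hx linear0.
have f'inj i : ~ injective (f' i) by exact: finj.
have f'0 : exists z, alt_comp f' z <> 0 by exists x; rewrite hE.
apply: leq_ltn_trans (IHk f' f'inj f'0) _.
have [y y0 gy] := ker_neq0 (f := g) (finj ord_max).
have rhx : range h (h x) by exists x.
(* The element [w] is new in the kernel: [h w] is the nonzero [z], which [g] kills. *)
have [z z0 [[w _ wz] gz]] := uniform_meet (@alt_uniform k uL uM)
  (submodule_image h (@submoduleT R L)) (submodule_ker g) rhx hx gy y0.
have -> : [set x | alt_comp f' x = 0] = [set x | h x = 0].
  by apply/seteqP; split=> u /=; rewrite hE.
have -> : [set x | alt_comp f x = 0] = [set x | (g \o h) x = 0].
  by apply/seteqP; split=> u; rewrite /= -fE.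
apply: jumps_proper => //; [exact: submodule_ker|exact: submodule_ker|].
split=> [u /= ->|/(_ w)]; first exact: linear0.
by move=> /= hw; apply: z0; rewrite -wz hw// wz.
Qed.

(** The return clause abstracts [odd k], so that each branch gets its own source and target;
    [odd k.+1] computes to [~~ odd k]. *)
Definition alternate (f : {linear L -> M}) (g : {linear M -> L}) (k : nat) :
    {linear alt L M k -> alt L M k.+1} :=
  if odd k as b
  return {linear (if b then M else L) -> (if ~~ b then M else L)}
  then g else f.

Lemma alternate_fixed (f : {linear L -> M}) (g : {linear M -> L}) x k :
  g (f x) = x ->
  alt_comp (fun i : 'I_k => alternate f g i) x =
  if odd k as b return (if b then M else L) then f x else x.
Proof.
(* [F] and [X] depend on a free boolean, which allows a case analysis on parity that the dependent
   types would otherwise block. *)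
move=> gfx; pose F b :=
  if b as b return {linear (if b then M else L) -> (if ~~ b then M else L)}
  then g else f.
pose X b := if b as b return ((if b then M else L) : lmodType R) then f x else x.
have FX b : F b (X b) = X (~~ b) by case: b.
elim: k => // k IHk.
rewrite -[LHS]/(alternate f g k (alt_comp (fun i : 'I_k => alternate f g i) x)).
by rewrite IHk; exact: FX.
Qed.

End Alternation.

Theorem theorem2p2 (R : pzRingType) (n : nat) (hn : (1 <= n)%N)
    (L M : lmodType R) (uL : uniform L) (uM : uniform M)
    (lL : has_length L n) (lM : has_length M n) :
  [<-> isomorphic L M;
       exists (f : {linear L -> M}) (g : {linear M -> L}) (x : L),
         x <> 0 /\ (g \o f) x = x;
       exists f : forall i : 'I_n, {linear alt L M i -> alt L M i.+1},
         alt_comp f <> (fun _ => 0)].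
Proof.
split; [|split].
- move=> [f /linear_inverse[g fK _]].
  by have [x x0] := has_length_neq0 hn lL; exists f, g, x; rewrite /= fK.
- move=> [f [g [x [x0 gfx]]]]; exists (fun i : 'I_n => alternate f g i).
  (* At [x] the composition takes the value [x] or [f x] by the parity of [n], and [f x = 0] would
     give [x = g (f x) = 0]. *)
  move=> /(congr1 (@^~ x)); rewrite alternate_fixed// /alt.
  case: (odd n) => // fx; apply: x0; rewrite -gfx /=.
  by rewrite [f x]fx linear0.
- move=> [f /alt_comp_neq0 f0]; apply: contrapT => nLM.
  have LMinj (h : {linear L -> M}) : ~ injective h.
    by move=> hinj; apply: nLM; exists h; exact: has_length_inj_bij lL lM hinj.
  have MLinj (h : {linear M -> L}) : ~ injective h.
    move=> hinj; apply: nLM; apply: isomorphic_sym.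
    by exists h; exact: has_length_inj_bij lM lL hinj.
  have [N csN] := lL.
  (* The kernel of the whole composition has at least [n] jumps, yet it is proper in [L], which has
     at most [n]. *)
  have := alt_comp_ker_jumps csN uL uM
    (fun i => alt_not_injective LMinj MLinj) f0.
  apply/negP; rewrite -ltnNge.
  apply: leq_trans (card_jumps_le N [set: L]).
  have [h hE] := alt_comp_linear f.
  have -> : [set x | alt_comp f x = 0] = [set x | h x = 0].
    by apply/seteqP; split=> u /=; rewrite hE.
  apply: jumps_proper => //; [exact: submodule_ker|exact: submoduleT|].
  by split=> // hT; have [x] := f0; apply; rewrite hE; exact: hT.
Qed.
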